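(* Consider $\pi_1$ under the measure $\mathcal{P}_n^{(q_n)}$, where $\{q_n\}$ is a bounded sequence with $q_n>1$ and $q_n-1=\omega(\frac1n)$ (equivalently, $\frac1n=o(q_n-1)$). Then, as $n\to\infty$, $\frac{\pi_1}{n}$ converges in distribution to the uniform distribution on $[0,1]$. Also, for fixed $q>1$, $$\mathcal{P}_n^{(q)}(\pi_1=k)=\frac1n q^{k-1}(q-1)\sum_{j=k}^n\frac1{q^j-1},\quad k=1,2,\ldots,n;$$ $$\mathcal{P}_n^{(q)}(\pi_1=n-k)\sim\frac1n\left(1-\frac1{q^{k+1}}\right)\ \text{as } n\to\infty,\quad k=0,1,\ldots.$$
   Context: Write $[n]=\{1,\ldots,n\}$ and let $S_n$ be the set of permutations of $[n]$, written in one-line notation $\sigma=\sigma_1\cdots\sigma_n$; $\sigma^{-1}_k$ is the position of $k$ in $\sigma$. A parking function of length $n$ is a sequence $\pi=(\pi_1,\ldots,\pi_n)\in[n]^n$ with $|\{i:\pi_i\le j\}|\ge j$ for all $j\in[n]$; $PF_n$ is the set of these. The inversion statistic is $I_n(\sigma)=\sum_{1\le i<j\le n}1_{\sigma_j<\sigma_i}$. For $j\in[n]$ let $I_{n,<j}(\sigma)=\sum_{1\le i<j}1_{\sigma^{-1}_j<\sigma^{-1}_i}$ (the number of inversions of $\sigma$ involving $j$ and a number less than $j$) and $\tilde I_{n,<j}=I_{n,<j}+1$. For $q\in(0,\infty)$, the Mallows measure on $S_n$ is $P_n^{(q)}(\sigma)=q^{I_n(\sigma)}/K_n$, where $K_n=\sum_{\rho\in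 S_n}q^{I_n(\rho)}$ is the normalizing constant; $P_n$ denotes the uniform measure on $S_n$. The map $(\sigma,\tau)\mapsto(\tilde I_{n,<\tau_1}(\sigma),\ldots,\tilde I_{n,<\tau_n}(\sigma))$ sends $S_n\times S_n$ into $PF_n$, and $\mathcal{P}_n^{(q)}$ denotes the probability measure on $PF_n$ that is the image of $P_n^{(q)}\times P_n$ under this map. $\pi_1$ denotes the first coordinate of the random parking function $\pi=(\pi_1,\ldots,\pi_n)\in PF_n$ (the dependence on $n$ is suppressed). The notation $a_n\sim b_n$ means $a_n/b_n\to1$ as $n\to\infty$. *)

(* Defs.v *)
From HB Require Import structures.
From mathcomp Require Import all_boot all_order all_algebra all_fingroup.
From mathcomp Require Import all_classical all_reals all_analysis.

Set Implicit Arguments.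
Unset Strict Implicit.
Unset Printing Implicit Defensive.

Import Order.TTheory GRing.Theory Num.Theory.
Import numFieldNormedType.Exports.

Local Open Scope classical_set_scope.
Local Open Scope ring_scope.

(* Positions and labels 1, ..., n are represented by the ordinals 0, ..., n-1
   (only their relative order matters for the statistics below); [s i] is the
   label at position [i], and [(s^-1)%g k] is the position of the label [k]. *)

Definition inversions n (s : 'S_n) : nat :=
  (\sum_(i < n) \sum_(j < n | i < j) (s j < s i))%N.

Definition inv_lt n (s : 'S_n) (j : 'I_n) : nat :=
  (\sum_(i < n | i < j) ((s^-1)%g j < (s^-1)%g i))%N.

Lemma inv_lt_le n (s : 'S_n) (j : 'I_n) : (inv_lt s j <= j)%N.
Proof.
rewrite /inv_lt (leq_trans (leq_sum _ (fun i _ => leq_b1 _)))//.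
rewrite sum1_card cardE -(size_map val) -[leqRHS](size_iota 0).
apply: uniq_leq_size; first by rewrite (map_inj_uniq val_inj) enum_uniq.
by move=> _ /mapP[i + ->]; rewrite mem_enum unfold_in mem_iota.
Qed.

Lemma inv_lt_ltn n (s : 'S_n) (j : 'I_n) : ((inv_lt s j).+1 < n.+1)%N.
Proof. by rewrite ltnS (leq_ltn_trans (inv_lt_le s j)). Qed.

(* Unlike positions and labels, the entries of a parking function keep their
   actual values 1, ..., n; they live in ['I_n.+1] with 0 excluded. *)
Definition is_parking n (pi : {ffun 'I_n -> 'I_n.+1}) : bool :=
  [forall i, (0 < pi i)%N] &&
  [forall j : 'I_n.+1, (0 < j)%N ==> (j <= #|[set i | (pi i <= j)%N]%SET|)%N].

Record parking n := Parking {
  parking_val :> {ffun 'I_n -> 'I_n.+1};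
  _ : is_parking parking_val }.

HB.instance Definition _ n := [isSub for @parking_val n].
HB.instance Definition _ n := [Finite of parking n by <:].

Definition parking_of_ffun n (s t : 'S_n) : {ffun 'I_n -> 'I_n.+1} :=
  [ffun i => Ordinal (inv_lt_ltn s (t i))].

Lemma parking_of_proof n (s t : 'S_n) : is_parking (parking_of_ffun s t).
Proof.
apply/andP; split; apply/forallP => j; first by rewrite ffunE.
apply/implyP => _.
rewrite -[leqLHS]card_ord -(card_imset (mem 'I_j) (f := fun k : 'I_j =>
  (t^-1)%g (widen_ord (ltn_ord j : (j <= n)%N) k))); last first.
  by move=> k l /perm_inj /(congr1 val) /= kl; apply: val_inj.
apply/subset_leq_card/fintype.subsetP => _ /imsetP[k _ ->].
rewrite inE ffunE /= permKV.
by apply: leq_ltn_trans (inv_lt_le _ _) _; exact: (valP (k : 'I_j)).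
Qed.

Definition parking_of n (st : 'S_n * 'S_n) : parking n :=
  Parking (parking_of_proof st.1 st.2).

HB.instance Definition _ n := isPointed.Build (perm_type 'I_n) 1%g.
HB.instance Definition _ n := @isMeasurable.Build default_measure_display
  (perm_type 'I_n) discrete_measurable discrete_measurable0
  discrete_measurableC discrete_measurableU.

HB.instance Definition _ n :=
  isPointed.Build (parking n) (parking_of (1%g, 1%g)).
HB.instance Definition _ n := @isMeasurable.Build default_measure_display
  (parking n) discrete_measurable discrete_measurable0
  discrete_measurableC discrete_measurableU.

Section perm_measures.
Local Open Scope ereal_scope.
Context (R : realType) (n : nat).

Definition perm_measure (w : 'S_n -> {nonneg R}) (A : set 'S_n) : \bar R :=
  \sum_(s : 'S_n) (w s)%:num%:E * \d_s A.

Section measure.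
Variable w : 'S_n -> {nonneg R}.

Let perm_measure0 : perm_measure w set0 = 0.
Proof. by rewrite /perm_measure big1// => s _; rewrite measure0 mule0. Qed.

Let perm_measure_ge0 A : 0 <= perm_measure w A.
Proof. by apply: sume_ge0 => s _; rewrite mule_ge0// lee_fin. Qed.

Let perm_measure_sigma_additive : semi_sigma_additive (perm_measure w).
Proof.
move=> F mF tF mUF; rewrite [X in _ --> X](_ : _ =
    lim ((fun n => \sum_(0 <= i < n) perm_measure w (F i)) @ \oo)).
  apply: is_cvg_ereal_nneg_natsum => k _; exact: perm_measure_ge0.
rewrite nneseries_sum//; last first.
  by move=> s k _; rewrite mule_ge0// lee_fin.
apply: eq_bigr => /= s _.
exact: (@measure_semi_bigcup _ _ _ (mscale (w s) \d_s)).
Qed.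

HB.instance Definition _ := isMeasure.Build _ _ _ (perm_measure w)
  perm_measure0 perm_measure_ge0 perm_measure_sigma_additive.

Lemma perm_measure_setT (w1 : (\sum_(s : 'S_n) (w s)%:num = 1)%R) :
  perm_measure w setT = 1.
Proof.
rewrite /perm_measure; under eq_bigr do rewrite diracT mule1.
by rewrite sumEFin w1.
Qed.

End measure.

Definition mallows_norm (q : {posnum R}) : R :=
  (\sum_(s : 'S_n) q%:num ^+ inversions s)%R.

Lemma mallows_norm_gt0 q : (0 < mallows_norm q)%R.
Proof.
rewrite /mallows_norm (bigD1 1%g)//= ltr_pwDl ?exprn_gt0//.
by rewrite sumr_ge0// => s _; rewrite exprn_ge0.
Qed.

Lemma mallows_weight_ge0 q (s : 'S_n) :
  (0 <= q%:num ^+ inversions s / mallows_norm q)%R.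
Proof. by rewrite divr_ge0 ?exprn_ge0// ltW// mallows_norm_gt0. Qed.

Definition mallows (q : {posnum R}) : set 'S_n -> \bar R :=
  perm_measure (fun s => NngNum (mallows_weight_ge0 q s)).

HB.instance Definition _ q := Measure.on (mallows q).

Let mallows_setT q : mallows q setT = 1.
Proof.
apply: perm_measure_setT => /=.
by rewrite -mulr_suml mulfV// gt_eqF// mallows_norm_gt0.
Qed.

HB.instance Definition _ q :=
  Measure_isProbability.Build _ _ _ (mallows q) (mallows_setT q).

Definition uniform_perm : set 'S_n -> \bar R :=
  perm_measure (fun=> (#|{: 'S_n}|%:R^-1)%:nng%R).

HB.instance Definition _ := Measure.on uniform_perm.

Let uniform_perm_setT : uniform_perm setT = 1.
Proof.
apply: perm_measure_setT => /=.
by rewrite sumr_const -[LHS]mulr_natr mulVf// card_Sn pnatr_eq0 -lt0n fact_gt0.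
Qed.

HB.instance Definition _ :=
  Measure_isProbability.Build _ _ _ uniform_perm uniform_perm_setT.

End perm_measures.
Arguments uniform_perm R n : clear implicits.

Lemma measurable_parking_of n : measurable_fun setT (@parking_of n).
Proof.
move=> _ B _; rewrite setTI; apply: countable_measurable; last first.
  exact/finite_set_countable/finite_finset.
move=> [s t]; rewrite (_ : [set _] = [set s] `*` [set t]).
  exact: measurableX.
by apply/seteqP; split=> [_ ->//|[? ?] [/= -> ->]].
Qed.

HB.instance Definition _ n := isMeasurableFun.Build _ _ _ _ (@parking_of n)
  (@measurable_parking_of n).

Definition mallows_parking (R : realType) n (q : {posnum R}) :
    probability (parking n) R :=
  distribution (mallows q \x uniform_perm R n)%E (@parking_of n).

(* Parking functions of positive length [n.+1], so that there is a first
   coordinate. *)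
Definition first_coord n (pi : parking n.+1) : nat := pi ord0.

Definition first_coord_ratio (R : realType) n (pi : parking n.+1) : R :=
  (first_coord pi)%:R / n.+1%:R.

HB.instance Definition _ R n := isMeasurableFun.Build _ _ _ _
  (@first_coord_ratio R n) (fun _ _ _ => I).

Definition cvg_in_distribution (R : realType) (d : nat -> measure_display)
    (T : forall n, measurableType (d n)) (P : forall n, probability (T n) R)
    (X : forall n, {RV (P n) >-> R}) (nu : probability (measurableTypeR R) R) :
    Prop :=
  forall x : R, {for x, continuous (fun y : R => nu `]-oo, y]%classic)} ->
    cdf (X n) x @[n --> \oo] --> nu `]-oo, x]%classic.

(* Main.v *)
(* The numbers [inv_lt s j] form a Lehmer code: they determine [s], take every
   value in [0..j] independently of each other, and add up to [inversions s].
   Hence under the Mallows measure they are independent truncated geometric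
   variables, and the first coordinate is one of them (plus one), chosen
   uniformly: the exact formula for its law follows, and then its asymptotics
   at [n - k].  Summing the geometric weights, P(pi_1 <= r) is the average over
   j in [1..n] of (q^min(r,j) - 1)/(q^j - 1), which is 1 for j <= r and at most
   q^(r-j) otherwise; so it lies between r/n and r/n + 1/(n(q-1)) when r <= n,
   and the error vanishes as soon as n(q_n - 1) tends to infinity. *)
Require Import Defs.
From HB Require Import structures.
From mathcomp Require Import all_boot all_order all_algebra all_fingroup.
From mathcomp Require Import all_classical all_reals all_analysis.
From mathcomp Require Import ring.

Set Implicit Arguments.
Unset Strict Implicit.
Unset Printing Implicit Defensive.

Import Order.TTheory GRing.Theory Num.Theory.
Import numFieldNormedType.Exports.
Local Open Scope classical_set_scope.
Local Open Scope ring_scope.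

(** * Lehmer codes of permutations *)

Lemma inversions_sum_inv_lt n (s : 'S_n) :
  inversions s = (\sum_(j < n) inv_lt s j)%N.
Proof.
(* Reindexing both sums by [s^-1] replaces positions by labels; condition and summand then trade
   roles, so each inversion is counted at its larger label. *)
rewrite /inversions /inv_lt (reindex_inj (@perm_inj _ s^-1%g)) /=.
apply: eq_bigr => j _; rewrite (reindex_inj (@perm_inj _ s^-1%g)) /=.
rewrite big_mkcond [RHS]big_mkcond /=; apply: eq_bigr => i _.
by rewrite !permKV; do 2 case: ltnP => //.
Qed.

(** Labels are inserted in increasing order: once the smaller labels are ordered among themselves,
    the code at [j] tells how many of them lie to the right of [j], hence where [j] goes. *)
Lemma inv_lt_inj n (s t : 'S_n) : inv_lt s =1 inv_lt t -> s = t.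
Proof.
move=> st; set u := (s^-1)%g; set v := (t^-1)%g.
have card_lt (w : 'S_n) (j : 'I_n) :
    inv_lt w j =
      #|[set i : 'I_n | (i < j)%N && ((w^-1)%g j < (w^-1)%g i)%N]%SET|.
  rewrite /inv_lt -sum1dep_card big_mkcondr /=; apply: eq_bigr => i _.
  by case: (_ < _)%N.
(* Two up-sets of the same finite chain with equal cardinals are equal, so the
   position of [j] relative to the smaller labels is determined by [inv_lt]. *)
have step (a b : 'S_n) (j i : 'I_n) : inv_lt a j = inv_lt b j ->
    (forall k l : 'I_n, (k < j)%N -> (l < j)%N ->
      ((a^-1)%g k < (a^-1)%g l)%N = ((b^-1)%g k < (b^-1)%g l)%N) ->
    (i < j)%N -> ((a^-1)%g j < (a^-1)%g i)%N -> ((b^-1)%g j < (b^-1)%g i)%N.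
  move=> abj IH ij aji; case: ltnP => // bij.
  have: (#|[set k : 'I_n | (k < j)%N && ((b^-1)%g j < (b^-1)%g k)%N]%SET| <
         #|[set k : 'I_n | (k < j)%N && ((a^-1)%g j < (a^-1)%g k)%N]%SET|)%N.
    apply: proper_card; apply/properP; split.
      apply/fintype.subsetP => k; rewrite !inE => /andP[kj bjk].
      by rewrite kj /= (ltn_trans aji)// IH// (leq_ltn_trans bij).
    by exists i; rewrite !inE ij ?aji// -leqNgt.
  by rewrite -!card_lt abj ltnn.
have same m : forall i j : 'I_n, (i < m)%N -> (j < m)%N ->
    (u i < u j)%N = (v i < v j)%N.
  elim: m => // m IH.
  have last (i j : 'I_n) : (i < m)%N -> j = m :> nat ->
      (u j < u i)%N = (v j < v i)%N.
    move=> im jm; apply/idP/idP; apply: step => //; rewrite ?jm//.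
    by move=> k l km lm; rewrite -/u -/v IH.
  have neq (w : 'S_n) (i j : 'I_n) : i != j -> (w i < w j)%N = ~~ (w j < w i)%N.
    move=> ij; rewrite -leqNgt ltn_neqAle.
    by rewrite (inj_eq val_inj) (inj_eq perm_inj) ij.
  move=> i j; rewrite !ltnS (leq_eqVlt i) (leq_eqVlt j).
  move=> /orP[/eqP im|im] /orP[/eqP jm|jm].
  - have ij : i = j by apply: val_inj; exact: etrans im (esym jm).
    by rewrite ij !ltnn.
  - exact: last.
  - have ij : i != j by apply: contraTneq im => ->; rewrite jm ltnn.
    by rewrite neq// [RHS]neq// last.
  - exact: IH.
(* Relative order is enough: the value of a permutation at [i] is the number of its smaller
   values. *)
have ranks (w : 'S_n) (i : 'I_n) :
    w i = #|[set k : 'I_n | (w k < w i)%N]%SET| :> nat.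
  rewrite -[LHS]card_ord -(card_imset (mem 'I_(w i)) (f := fun k : 'I_(w i) =>
    (w^-1)%g (widen_ord (ltnW (ltn_ord (w i))) k))); last first.
    by move=> k l /perm_inj /(congr1 val) /= kl; apply: val_inj.
  apply: eq_card => k; rewrite inE; apply/imsetP/idP => [[l _ ->]|kl].
    by rewrite permKV /=.
  exists (Ordinal kl) => //; apply: (@perm_inj _ w).
  by rewrite permKV; apply: val_inj.
apply: invg_inj; apply/permP => i; apply: val_inj.
rewrite /= -/u -/v (ranks u) (ranks v).
by apply: eq_card => k; rewrite !inE (same n).
Qed.

(** Values are taken in ['I_n] rather than ['I_j.+1] to get a non-dependent function; the bound by
    [j] returns as the family [Q] below. *)
Definition lehmer n (s : 'S_n) : {ffun 'I_n -> 'I_n} :=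
  [ffun j => Ordinal (leq_ltn_trans (inv_lt_le s j) (ltn_ord j))].

(** Independence of the coordinates in algebraic form: the codes are distinct and lie in a family of
    cardinal [n!], so they fill it, and distributivity factors the sum. *)
Lemma sum_lehmer (T : comPzSemiRingType) n (P : 'I_n -> pred 'I_n)
    (F : 'I_n -> 'I_n -> T) :
  \sum_(s : 'S_n | [forall j, P j (lehmer s j)]) \prod_j F j (lehmer s j) =
  \prod_(j < n) \sum_(i < n | (i <= j)%N && P j i) F j i.
Proof.
pose Q (j i : 'I_n) := (i <= j)%N.
have lehmer_inj : injective (@lehmer n).
  move=> s t /ffunP st; apply: inv_lt_inj => j.
  by have /(congr1 val) := st j; rewrite !ffunE.
have lehmer_family s : lehmer s \in family Q.
  by apply/familyP => j; rewrite unfold_in /Q ffunE inv_lt_le.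
have card_family : #|family Q| = n`!%N.
  rewrite -sum1_card.
  (* The same distributivity, applied to the constant 1, counts the family. *)
  have <- : (\prod_j \sum_(i | Q j i) 1 = \sum_(f in family Q) 1)%N.
    by rewrite bigA_distr_big_dep; apply: eq_bigr => f _; rewrite big1.
  rewrite fact_prod big_add1 big_mkord; apply: eq_bigr => j _.
  rewrite sum1dep_card -[RHS](card_ord) -(card_imset (mem 'I_j.+1) (f :=
    widen_ord (ltn_ord j : (j < n)%N))); last first.
    by move=> k l /(congr1 val) /= kl; apply: val_inj.
  apply: eq_card => k; rewrite inE unfold_in; apply/idP/imsetP => [kj|[l _ ->]].
    by exists (Ordinal (kj : (k < j.+1)%N)) => //; apply: val_inj.
  exact: (ltn_ord l).
have codom_lehmer : [set lehmer s | s : 'S_n]%SET =i family Q.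
  apply/subset_cardP; last by apply/fintype.subsetP => _ /imsetP[s _ ->].
  by rewrite card_family card_imset// card_Sn.
pose PQ (j i : 'I_n) := Q j i && P j i.
rewrite [RHS](bigA_distr_big_dep PQ F).
rewrite (eq_bigl (fun f => (f \in [set lehmer s | s : 'S_n]%SET) &&
    [forall j, P j (f j)])); last first.
  move=> f; rewrite codom_lehmer.
  apply/familyP/andP => [h|[/familyP h /forallP h'] j].
    split; last by apply/forallP => j; have /andP[] := h j.
    by apply/familyP => j; have /andP[] := h j.
  by rewrite unfold_in /PQ h' andbT; exact: h.
by rewrite big_imset_cond//= => s t _ _; exact: lehmer_inj.
Qed.

Lemma prod_expr_lehmer (T : comNzRingType) n (q : T) (s : 'S_n) :
  q ^+ inversions s = \prod_j q ^+ lehmer s j.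
Proof.
by rewrite inversions_sum_inv_lt -prodrXr; apply: eq_bigr => j _; rewrite ffunE.
Qed.

(** * Law of the first coordinate *)

Lemma sum_ord_lt (V : nmodType) n m (F : nat -> V) : (m <= n)%N ->
  \sum_(i < n | (i < m)%N) F i = \sum_(i < m) F i.
Proof. by move=> mn; rewrite (big_ord_widen _ F mn). Qed.

Lemma perm_measureE (R : realType) n (w : 'S_n -> {nonneg R}) (b : pred 'S_n) :
  perm_measure w [set s | b s] = (\sum_(s | b s) (w s)%:num)%:E.
Proof.
rewrite /perm_measure -sumEFin [RHS]big_mkcond /=; apply: eq_bigr => s _.
rewrite diracE; case: ifPn => [bs|/negP bs].
  by rewrite mem_set// mule1.
by rewrite memNset// mule0.
Qed.

Section law_of_first_coord.
Context (R : realType) (n : nat) (q : {posnum R}).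

Let geom_gt0 m : 0 < \sum_(i < m.+1) q%:num ^+ i.
Proof.
by rewrite big_ord_recl ltr_pwDl// sumr_ge0// => i _; rewrite exprn_ge0.
Qed.

(** The product is the q-factorial of [n]. *)
Lemma mallows_normE :
  mallows_norm n q = \prod_(k < n) \sum_(i < k.+1) q%:num ^+ i.
Proof.
rewrite /mallows_norm; under eq_bigr do rewrite prod_expr_lehmer.
pose P (k i : 'I_n) := true.
rewrite (eq_bigl (fun s => [forall k, P k (lehmer s k)])); last first.
  by move=> s; apply/esym/forallP.
rewrite (sum_lehmer P (fun _ i => q%:num ^+ i)).
apply: eq_bigr => k _; rewrite -(@sum_ord_lt _ n)//.
by apply: eq_bigl => i; rewrite andbT.
Qed.

(** The event restricts one coordinate of the code only; all other factors cancel against the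
    q-factorial. *)
Lemma mallows_inv_lt (j : 'I_n) (B : pred nat) :
  mallows q [set s | B (inv_lt s j)] =
  ((\sum_(i < j.+1 | B i) q%:num ^+ i) / \sum_(i < j.+1) q%:num ^+ i)%:E.
Proof.
rewrite /mallows perm_measureE /=; congr EFin; rewrite -mulr_suml.
under [X in X / _ = _]eq_bigr do rewrite prod_expr_lehmer.
pose P (k i : 'I_n) := (k == j) ==> B i.
rewrite (eq_bigl (fun s => [forall k, P k (lehmer s k)])); last first.
  move=> s; apply/idP/forallP => [Bs k|/(_ j)]; last by rewrite /P eqxx ffunE.
  by apply/implyP => /eqP ->; rewrite ffunE.
rewrite (sum_lehmer P (fun _ i => q%:num ^+ i)) mallows_normE.
rewrite (bigD1 j)//= [X in _ / X](bigD1 j)//=.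
have -> : \sum_(i < n | (i <= j)%N && P j i) q%:num ^+ i =
    \sum_(i < j.+1 | B i) q%:num ^+ i.
  rewrite big_mkcondr [RHS]big_mkcond /=.
  rewrite -(@sum_ord_lt _ n _ (fun i => if B i then q%:num ^+ i else 0))//.
  by apply: eq_bigr => i _; rewrite /P eqxx.
rewrite (eq_bigr (fun k : 'I_n => \sum_(i < k.+1) q%:num ^+ i)); last first.
  move=> k kj; rewrite -(@sum_ord_lt _ n)//.
  by apply: eq_bigl => i; rewrite /P (negbTE kj) andbT.
by rewrite -mulf_div divff ?mulr1// gt_eqF// prodr_gt0.
Qed.

End law_of_first_coord.

Lemma uniform_perm_pointwise (R : realType) n (i j : 'I_n) :
  uniform_perm R n [set t : 'S_n | t i == j] = (n%:R^-1)%:E.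
Proof.
have n0 : (n%:R : R) != 0.
  by rewrite pnatr_eq0 -lt0n (leq_ltn_trans _ (ltn_ord i)).
rewrite /uniform_perm perm_measureE /=; congr EFin.
(* Composing with a transposition exchanges the images [j] and [k], so all values at [i] are equally
   likely. *)
have same k : \sum_(t : 'S_n | t i == k) (#|{: 'S_n}|%:R^-1 : R) =
    \sum_(t : 'S_n | t i == j) #|{: 'S_n}|%:R^-1.
  rewrite (reindex_inj (mulIg (tperm j k))) /=; apply: eq_bigl => t.
  by rewrite permM -[X in _ == X](tpermL j k) (inj_eq perm_inj).
have : \sum_(t : 'S_n) (#|{: 'S_n}|%:R^-1 : R) = 1.
  rewrite sumr_const -[LHS]mulr_natr mulVf// card_Sn.
  by rewrite pnatr_eq0 -lt0n fact_gt0.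
rewrite (partition_big (fun t : 'S_n => t i) predT)//=.
rewrite (eq_bigr _ (fun k _ => same k)).
rewrite sumr_const card_ord -[LHS]mulr_natr => tot.
by apply: (mulIf n0); rewrite mulVf.
Qed.

(** [B] is arbitrary so that singletons give point probabilities and initial segments give the
    distribution function. *)
Lemma mallows_parking_first_coord (R : realType) n (q : {posnum R})
    (B : pred nat) :
  mallows_parking n.+1 q [set pi | B (first_coord pi)] =
  (n.+1%:R^-1 * \sum_(j < n.+1) (\sum_(i < j.+1 | B i.+1) q%:num ^+ i) /
                                 \sum_(i < j.+1) q%:num ^+ i)%:E.
Proof.
(* Splitting by the label [j] that the uniform permutation puts first gives disjoint rectangles. *)
pose F (j : 'I_n.+1) := [set s : 'S_n.+1 | B (inv_lt s j).+1] `*`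
  [set t : 'S_n.+1 | t ord0 == j].
transitivity ((mallows q \x uniform_perm R n.+1)%E
  (\bigcup_(j in [set: 'I_n.+1]) F j)).
  congr ((_ \x _)%E _); apply/seteqP; split=> [[s t]|[s t] [j _ []]] /=.
    rewrite /first_coord /= ffunE /= => Bst.
    by exists (t ord0) => //; split => /=.
  by rewrite /first_coord /= ffunE /= => Bj /eqP ->.
rewrite measure_fin_bigcup//; last 3 first.
- exact: finite_finset.
- apply/trivIsetP => i j _ _ ij.
  apply/seteqP; split=> // -[s t] [[_ /= ti] [_ /= tj]].
  by move/negP: ij; apply; rewrite -(eqP ti) (eqP tj).
- by move=> j _; apply: measurableX.
rewrite (_ : [set: 'I_n.+1] = [set` index_enum 'I_n.+1]); last first.
  by apply/seteqP; split=> // j _ /=; exact: mem_index_enum.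
rewrite -fsbig_seq ?index_enum_uniq// mulr_sumr -sumEFin; apply: eq_bigr => j _.
transitivity (mallows q [set s | B (inv_lt s j).+1] *
    uniform_perm R n.+1 [set t : 'S_n.+1 | t ord0 == j])%E.
  exact: product_measure1E.
by rewrite (mallows_inv_lt q j (fun i => B i.+1)) uniform_perm_pointwise muleC.
Qed.

(** * Closed form of the point probabilities *)

Lemma sum_expr_geometric (R : fieldType) (q : R) m : q - 1 != 0 ->
  \sum_(i < m) q ^+ i = (q ^+ m - 1) / (q - 1).
Proof. by move=> q1; rewrite subrX1 mulrC mulKf. Qed.

Lemma mallows_parking_first_coord_eq (R : realType) n (q : {posnum R}) m :
  1 < q%:num ->
  mallows_parking n.+1 q [set pi | first_coord pi = m.+1] =
  (n.+1%:R^-1 * q%:num ^+ m * (q%:num - 1) *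
     \sum_(m.+1 <= j < n.+2) (q%:num ^+ j - 1)^-1)%:E.
Proof.
move=> q1; have qB1 : q%:num - 1 != 0 by rewrite subr_eq0 gt_eqF.
rewrite (_ : [set pi | _] =
    [set pi : parking n.+1 | first_coord pi == m.+1]); last first.
  by apply/seteqP; split=> pi /= /eqP.
rewrite (mallows_parking_first_coord _ q (pred1 m.+1)) -!mulrA.
congr EFin; congr (_ * _).
(* The ordinal [j] stands for the exponent [j.+1]; its inner sum is the single weight [q ^+ m] if
   [m <= j], and is empty otherwise. *)
rewrite !mulr_sumr big_add1 /= (@big_nat_widenl _ _ _ m 0)//= big_mkord.
rewrite [RHS]big_mkcond /=; apply: eq_bigr => j _.
rewrite sum_expr_geometric// invf_div; case: leqP => mj.
  by rewrite (big_pred1 (Ordinal (mj : (m < j.+1)%N)))//.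
rewrite big_pred0 ?mul0r// => i; rewrite eqSS; apply/negP => /eqP im.
by move: (ltn_ord i); rewrite im ltnS leqNgt mj.
Qed.

(** * Distribution functions: the uniform limit and the truncated geometric bounds *)

Lemma uniform_prob_cdf (R : realType) (x : R) :
  (uniform_prob (@ltr01 R) : probability (measurableTypeR R) R)
    `]-oo, x]%classic = (Num.max 0 (Num.min x 1))%:E.
Proof.
rewrite [LHS]integral_uniform_pdf.
rewrite (_ : `]-oo, x] `&` `[0, 1] = `[0, Num.min x 1]%classic); last first.
  apply/seteqP; split=> y /=; rewrite !in_itv/= le_min.
    by case=> -> /andP[-> ->].
  by move=> /and3P[-> -> ->].
rewrite (eq_integral (cst 1%E)); last first.
  move=> y; rewrite inE /= in_itv/= le_min /uniform_pdf => /and3P[-> _ ->] /=.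
  by rewrite subr0 invr1.
rewrite integral_cst//= mul1e lebesgue_measure_itv/= lte_fin oppr0 adde0.
by rewrite maxElt; case: ifPn.
Qed.

(** The first [r] terms equal 1, the later ones are at most [q^-1], [q^-2], and so on. Keeping the
    finite geometric sum as error lets the induction on [n] close; truncated subtraction makes it
    vanish for [n <= r]. *)
Lemma truncated_geometric_cdf_sum (R : realFieldType) (q : R) r n : 1 < q ->
  (minn r n)%:R <=
    \sum_(j < n) (\sum_(i < j.+1 | (i < r)%N) q ^+ i) / \sum_(i < j.+1) q ^+ i <=
  (minn r n)%:R + (1 - q ^- (n - r)) / (q - 1).
Proof.
move=> q1; have q0 : 0 < q by apply: lt_trans q1.
have qB1 : 0 < q - 1 by rewrite subr_gt0.
have qX m : 0 < q ^+ m.+1 - 1 by rewrite subr_gt0 exprn_egt1.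
elim: n => [|n IH].
  by rewrite big_ord0 minn0 sub0n expr0 invr1 subrr mul0r addr0 lexx.
rewrite big_ord_recr /=.
have geom m : \sum_(i < m) q ^+ i = (q ^+ m - 1) / (q - 1).
  by rewrite sum_expr_geometric ?gt_eqF.
case: (ltnP n r) IH => nr.
  have -> : \sum_(i < n.+1 | (i < r)%N) q ^+ i = \sum_(i < n.+1) q ^+ i.
    by apply: eq_bigl => i; rewrite (leq_trans (ltn_ord i)).
  rewrite divff ?geom ?gt_eqF ?divr_gt0//.
  move/eqP: (nr) (ltnW nr) => -> /eqP ->; rewrite (minn_idPr nr).
  by rewrite expr0 invr1 subrr mul0r !addr0 -natr1 !lerD2r.
rewrite (minn_idPl (leqW nr)) subSn// => /andP[IHl IHr].
rewrite (sum_ord_lt (GRing.exp q) (leqW nr)) !geom.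
have -> : (q ^+ r - 1) / (q - 1) / ((q ^+ n.+1 - 1) / (q - 1)) = 
   (q ^+ r - 1) / (q ^+ n.+1 - 1).
  by rewrite invf_div mulrA mulfVK ?gt_eqF.
have r1 : 1 <= q ^+ r by rewrite exprn_ege1 ?ltW.
apply/andP; split.
  rewrite (le_trans IHl)// lerDl; apply: divr_ge0; last exact: ltW.
  by rewrite subr_ge0.
(* Multiplied out, the bound on the new term reads [q ^+ n.+1 - q ^+ (n - r).+1 <= q ^+ n.+1 -
   1]. *)
apply: le_trans (lerD IHr (_ : _ <= q ^- (n - r).+1)) _.
  rewrite ler_pdivrMr// ler_pdivlMl ?exprn_gt0//.
  rewrite -[in leRHS](subnK nr) -addSn exprD mulrBr mulr1 lerB//.
  by rewrite exprn_ege1 ?ltW.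
rewrite -addrA lerD2l; set m := (n - r)%N.
have qm : q ^+ m != 0 by rewrite expf_neq0// gt_eqF.
suff -> : (1 - q ^- m) / (q - 1) + q ^- m.+1 = (1 - q ^- m.+1) / (q - 1) by [].
by rewrite exprS; field; rewrite qm !gt_eqF.
Qed.

(** * Asymptotics at the top values *)

Lemma cvg_expr_ratio (R : realType) (q : R) i : 1 < q ->
  (q - 1) * q ^+ n / (q ^+ (n + i.+1) - 1) @[n --> \oo] --> (q - 1) / q ^+ i.+1.
Proof.
move=> q1; have q0 : 0 < q by apply: lt_trans q1.
(* Numerator and denominator are divided by [q ^+ n], leaving only [q^-1 ^+ n], which tends to 0. *)
rewrite (_ : (fun n => _) =
    (fun n => (q - 1) / (q ^+ i.+1 - q^-1 ^+ n))); last first.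
  apply/funext => n; rewrite -mulrA; congr (_ * _).
  rewrite exprD exprVn -(mulfV (_ : q ^+ n != 0)) ?expf_neq0 ?gt_eqF//.
  by rewrite -mulrBr invfM mulrA mulfV ?mul1r// expf_neq0 ?gt_eqF.
apply: cvgM; first exact: cvg_cst.
apply: cvgV; first by rewrite expf_neq0 ?gt_eqF.
rewrite -[X in _ --> X]subr0; apply: cvgB; first exact: cvg_cst.
by apply: cvg_expr; rewrite ger0_norm ?invr_ge0 ?invf_lt1 ?ltW.
Qed.

(** For fixed [k] the exact formula has [k.+1] terms, so the limit is taken termwise; the limits
    form a geometric sum equal to [c]. *)
Lemma mallows_parking_first_coord_top (R : realType) (q : {posnum R}) k :
  1 < q%:num ->
  fine (mallows_parking n.+1 q [set pi | first_coord pi = (n.+1 - k)%N]) /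
    (n.+1%:R^-1 * (1 - (q%:num ^+ k.+1)^-1)) @[n --> \oo] --> (1 : R).
Proof.
move=> q1; have q0 : 0 < q%:num by [].
have c0 : 1 - (q%:num ^+ k.+1)^-1 != 0.
  by rewrite subr_eq0 eq_sym lt_eqF// invf_lt1 ?exprn_egt1// exprn_gt0.
set p := fun n => _; set c := 1 - _ in c0.
(* Shifting [n] by [k] turns the truncated [n.+1 - k] into the positive value [n.+1]. *)
have p_shift n : p (n + k)%N = (\sum_(i < k.+1)
    (q%:num - 1) * q%:num ^+ n / (q%:num ^+ (n + i.+1) - 1)) / c.
  have nk : ((n + k).+1 - k)%N = n.+1 by rewrite -addSn addnK.
  rewrite /p -/c nk mallows_parking_first_coord_eq//= invfM invrK.
  rewrite mulrA; congr (_ / c); rewrite mulrC !mulrA mulfV ?pnatr_eq0// mul1r.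
  have -> : ((n + k).+2 = k.+1 + n.+1)%N by rewrite addnC -addSn -addnS.
  rewrite -[X in \sum_(X <= _ < _) _]add0n big_addn addnK big_mkord mulr_sumr.
  by apply: eq_bigr => i _; rewrite addnC addSnnS [(q%:num - 1) * _]mulrC.
rewrite -(cvg_shiftn k) (funext p_shift).
have c_sum : c = \sum_(i < k.+1) (q%:num - 1) / q%:num ^+ i.+1.
  under eq_bigr do rewrite -exprVn exprS mulrA mulrBl mulfV ?gt_eqF// mul1r.
  by rewrite -mulr_sumr /c -exprVn -opprB subrX1 -mulNr opprB.
have cvg_num : (\sum_(i < k.+1) (q%:num - 1) * q%:num ^+ n /
    (q%:num ^+ (n + i.+1) - 1)) @[n --> \oo] --> c.
  rewrite c_sum; apply: cvg_big => [|i _]; first exact: add_continuous.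
  exact: cvg_expr_ratio.
by have := cvgM cvg_num (cvg_cst c^-1); rewrite divff//; apply.
Qed.

(** * Convergence in distribution *)

Lemma mallows_parking_first_coord_le (R : realType) n (q : {posnum R}) r :
  1 < q%:num -> exists F : R,
  [/\ mallows_parking n.+1 q [set pi | (first_coord pi <= r)%N] = F%:E,
      (minn r n.+1)%:R / n.+1%:R <= F &
      F <= (minn r n.+1)%:R / n.+1%:R + n.+1%:R^-1 / (q%:num - 1)].
Proof.
move=> q1; rewrite (mallows_parking_first_coord _ q (fun k => (k <= r)%N)).
eexists; split; first by [].
all: have /andP[lo hi] := truncated_geometric_cdf_sum r n.+1 q1.
  by rewrite [leRHS]mulrC ler_pM2r ?invr_gt0.
rewrite (mulrC _ (q%:num - 1)^-1) -mulrDl mulrC ler_pM2r ?invr_gt0//.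
apply: le_trans hi _; rewrite lerD2l ler_pdivrMr ?subr_gt0// mulVf; last first.
  by rewrite subr_eq0 gt_eqF.
by rewrite gerBl invr_ge0 exprn_ge0.
Qed.

(** Truncation costs less than 1, hence less than [harmonic n] after division, and [minn] clamps the
    ratio just as [c] clamps [x]. *)
Lemma cvg_minn_truncn (R : realType) (x : R) :
  (minn (Num.trunc (x * n.+1%:R)) n.+1)%:R / n.+1%:R @[n --> \oo] -->
  Num.max 0 (Num.min x 1).
Proof.
set c := Num.max 0 _.
have cvg_lo : c - harmonic n @[n --> \oo] --> c.
  by have := cvgB (cvg_cst c) (@cvg_harmonic R); rewrite subr0; apply.
apply: (squeeze_cvgr _ cvg_lo (cvg_cst c)); apply: nearW => n /=.
have N0 : 0 < n.+1%:R :> R by [].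
set T := Num.trunc _; rewrite lerBlDr -[X in _ + X]mul1r -mulrDl.
rewrite ler_pdivlMr// ler_pdivrMr//.
(* For negative [x], [Num.trunc] takes its default value 0, which is also the clamped limit. *)
case: (leP 0 x) => x0; last first.
  have -> : T = 0%N.
    apply/eqP; rewrite -leqn0 leqNgt truncn_gt0 -ltNge.
    by rewrite (lt_trans _ ltr01)// pmulr_llt0.
  have -> : c = 0 by apply/max_idPl; rewrite ge_min ltW.
  by rewrite min0n add0r mul0r ler01 lexx.
have /andP[Tlo Thi] : T%:R <= x * n.+1%:R < T.+1%:R.
  by rewrite truncn_itv// mulr_ge0.
have -> : c = Num.min x 1 by apply/max_idPr; rewrite le_min x0 ler01.
case: (leqP T n.+1) => TN.
  rewrite (minr_pMl _ _ (ltW N0)) mul1r natr1.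
  by rewrite le_min ge_min (ltW Thi) Tlo /= ler_nat TN.
have x1 : 1 <= x.
  by rewrite -(ler_pM2r N0) mul1r (le_trans _ Tlo)// ler_nat ltnW.
by rewrite (min_idPr x1) mul1r lexx andbT lerDl.
Qed.

Theorem theorem5 (R : realType) :
  (forall q : nat -> {posnum R},
      bounded_fun (fun n => (q n)%:num : R) ->
      (forall n, (0 < n)%N -> 1 < (q n)%:num) ->
      (fun n => n%:R^-1 : R)%R =o_\oo (fun n => (q n)%:num - 1 : R)%R ->
      cvg_in_distribution
        (fun n => @first_coord_ratio R n
                  : {RV mallows_parking n.+1 (q n.+1) >-> R})
        (uniform_prob (@ltr01 R)))
  /\
  (forall q : {posnum R}, 1 < q%:num ->
      (forall n k : nat, (1 <= k <= n.+1)%N ->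
         mallows_parking n.+1 q [set pi | first_coord pi = k] =
         (n.+1%:R^-1 * q%:num ^+ (k - 1) * (q%:num - 1) *
            \sum_(k <= j < n.+2) (q%:num ^+ j - 1)^-1)%:E)
      /\
      (forall k : nat,
         fine (mallows_parking n.+1 q
                 [set pi | first_coord pi = (n.+1 - k)%N]) /
           (n.+1%:R^-1 * (1 - (q%:num ^+ k.+1)^-1)) @[n --> \oo] --> (1 : R))).
Proof.
split; last first.
  move=> q q1; split; last by move=> k; exact: mallows_parking_first_coord_top.
  by move=> n [//|m] _; rewrite mallows_parking_first_coord_eq// subn1.
move=> q _ q1 qo x _; rewrite uniform_prob_cdf.
(* [F] collects the real values of the distribution functions at [x], so that the squeeze takes
   place in [R]. *)
have [F FP] := choice (fun n => mallows_parking_first_coord_le n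
  (Num.trunc (x * n.+1%:R)) (q1 n.+1 isT)).
rewrite (_ : (fun n => _) = EFin \o F); last first.
  apply/funext => n /=; have [<- _ _] := FP n.
  rewrite /cdf /distribution /pushforward; congr (mallows_parking _ _ _).
  (* For negative [x] the truncation is 0 and not a floor; the equivalence survives because the
     first coordinate is positive. *)
  have le_trunc (pi : parking n.+1) :
      (first_coord pi <= Num.trunc (x * n.+1%:R))%N =
      (first_coord_ratio R pi <= x).
    have : (0 < first_coord pi)%N.
      by have /andP[/forallP ppos _] := valP pi; exact: ppos.
    rewrite /first_coord_ratio ler_pdivrMr//; case: first_coord => // m _.
    exact: truncn_gt_nat.
  by apply/seteqP; split=> pi /=; rewrite in_itv/= le_trunc.
(* The little-o hypothesis says that this ratio tends to 0; index 0, where [q] may fail to exceed 1,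
   is avoided by taking [n] large. *)
have small : n.+1%:R^-1 / ((q n.+1)%:num - 1) @[n --> \oo] --> (0 : R).
  rewrite (cvg_shiftS (fun n => n%:R^-1 / ((q n)%:num - 1))).
  apply/cvgr0Pnorm_le => e e0; near=> n.
  have n0 : (0 < n)%N by near: n; exists 1%N.
  have qn : 0 < (q n)%:num - 1 by rewrite subr_gt0 q1.
  rewrite normrM [X in _ * X]normfV ler_pdivrMr ?normr_gt0 ?gt_eqF//.
  by near: n; exact: (eqoP _ _ _).1 qo e e0.
have lo := @cvg_minn_truncn R x.
have hi := cvgD lo small; rewrite addr0 in hi.
apply: cvg_EFin; first exact: nearW.
apply: (squeeze_cvgr _ lo (hi _)); apply: nearW => n /=.
by have [_ -> ->] := FP n.
Unshelve. all: by end_near.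
Qed.
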